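(* Let $s \in (\frac12,1)$. If $f,g \in H^s$, then the pointwise product $fg$ belongs to $H^s$, with $$\|fg\|_{H^s}\le C\,\|f\|_{H^s}\|g\|_{H^s},$$ where $C>0$ is a constant independent of $f$ and $g$ (it may depend on $s$).
   Context: All functions are real-valued and defined on $I_0=[0,1]$; $L^2=L^2([0,1])$; $(f,g)=\int_{I_0} f(x)g(x)\,dx$. Dyadic system: $\mathcal D=\{2^{-j}([0,1)+k): j=0,1,2,\dots,\ k=0,\dots,2^j-1\}$. For $I\in\mathcal D$, $I_-,I_+$ are its left and right halves, and $h_I=|I|^{-1/2}(\mathbb 1_{I_-}-\mathbb 1_{I_+})$. Local dyadic fractional Sobolev space: $D^sf=\sum_{I\in\mathcal D}|I|^{-s}(f,h_I)h_I$, and $H^s$ is the set of $f\in L^2$ with $\|f\|_{H^s}^2:=\|D^sf\|_{L^2}^2+\|f\|_{L^2}^2<\infty$, where $\|D^sf\|_{L^2}^2=\sum_{I\in\mathcal D}|I|^{-2s}|(f,h_I)|^2$. *)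

(* Defs.v *)
From HB Require Import structures.
From mathcomp Require Import all_boot all_order all_algebra.
From mathcomp Require Import all_classical all_reals all_analysis.

Set Implicit Arguments.
Unset Strict Implicit.
Unset Printing Implicit Defensive.

Import Order.TTheory GRing.Theory Num.Theory.
Import numFieldNormedType.Exports.

Local Open Scope classical_set_scope.
Local Open Scope ring_scope.

(* A function on [0, 1] is given by f : R -> R, and only its values on [0, 1]
   are used.  Elements of L^2 are Borel representatives rather than
   a.e.-classes: every class has such a representative, and the integrals below
   do not depend on its choice. *)

(* The pair (j, k) with k < 2 ^ j encodes the dyadic interval
   2 ^ (- j) ([0, 1) + k). *)
Definition dyadic : set (nat * nat) := [set I | (I.2 < 2 ^ I.1)%N].

Definition dlen (R : realType) (I : nat * nat) : R := 2^-1 ^+ I.1.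

Definition ditv (R : realType) (I : nat * nat) : set R :=
  `[I.2%:R * dlen R I, I.2.+1%:R * dlen R I[%classic.

Definition dleft (I : nat * nat) : nat * nat := (I.1.+1, I.2.*2).
Definition dright (I : nat * nat) : nat * nat := (I.1.+1, I.2.*2.+1).

Definition haar (R : realType) (I : nat * nat) (x : R) : R :=
  (Num.sqrt (dlen R I))^-1 *
  (\1_(ditv (dleft I)) x - \1_(ditv (dright I)) x).

Definition inner01 (R : realType) (f g : R -> R) : R :=
  Rintegral (@lebesgue_measure R) `[0, 1]%classic (fun x => f x * g x).

Definition L2sq (R : realType) (f : R -> R) : \bar R :=
  (\int[@lebesgue_measure R]_(x in `[0%R, 1%R]) (`|f x| ^+ 2)%:E)%E.

Definition inL2 (R : realType) (f : R -> R) : Prop :=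
  measurable_fun (`[0, 1]%classic : set R) f /\ (L2sq f < +oo)%E.

(* The squared L^2 norm of D^s f, as the unordered sum of the squares of its
   Haar coefficients |I|^(-s) (f, h_I). *)
Definition Dssq (R : realType) (s : R) (f : R -> R) : \bar R :=
  (\esum_(I in dyadic)
     (dlen R I `^ (- (2 * s)) * `|inner01 f (haar I)| ^+ 2)%:E)%R.

Definition Hnormsq (R : realType) (s : R) (f : R -> R) : \bar R :=
  (Dssq s f + L2sq f)%E.

Definition Hnorm (R : realType) (s : R) (f : R -> R) : \bar R :=
  sqrte (Hnormsq s f).

Definition inH (R : realType) (s : R) (f : R -> R) : Prop :=
  inL2 f /\ (Hnormsq s f < +oo)%E.

(* Main.v *)
Require Import Defs.
From HB Require Import structures.
From mathcomp Require Import all_boot all_order all_algebra.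
From mathcomp Require Import all_classical all_reals all_analysis.
From mathcomp Require Import measurable_realfun.
From mathcomp Require Import ring lra zify.
Set Implicit Arguments.
Unset Strict Implicit.
Unset Printing Implicit Defensive.

Import Order.TTheory GRing.Theory Num.Theory.
Import numFieldNormedType.Exports.
Local Open Scope classical_set_scope.
Local Open Scope ring_scope.

(** The proof rests on martingale differences along the dyadic tree.  Write
A(I), B(I) for the averages of f, g over I, and DA(I), DB(I) for half the
difference of the averages over the two halves of I, so that
(f, h_I) = |I|^(1/2) DA(I).  The norm thus controls the sum over I of
|I|^(1 - 2s) DA(I)^2 (the [energy]).

For s > 1/2 a single term of that sum gives |DA(I)| <= r^j ||f|| at level j,
with r = 2^(1/2 - s) < 1.  Summing along the chain of ancestors of I bounds all
averages of f uniformly by a multiple of ||f|| ([martingale_bounded]); by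
Lebesgue differentiation f itself is bounded almost everywhere, which settles
the L^2 part of the norm of fg.

For the coefficients of fg, expand around averages.  With
S(I) = \int_I (f - A(I)) (g - B(I)), half the difference of the averages of fg
over the two halves I-, I+ of I is
    A(I) DB(I) + B(I) DA(I) + |I|^-1 (S(I-) - S(I+)).
The first two terms are handled by the uniform bound.  For the third,
S(I) is the sum of |J| DA(J) DB(J) over dyadic J inside I, by completeness of
the Haar system, so that by Cauchy-Schwarz S(I)^2 <= T_f(I) T_g(I), where
T_f(I) is the sum of |J| DA(J)^2 over J inside I.  Since
T_f(I) <= |I|^(2s) ||f||^2, the weighted square of the third term is at most
2 ||f||^2 |I|^-1 T_g(I) ([covariation_diff_le]), and in the sum over I a fixed J
receives the geometric series of |I|^-1 over its ancestors I, that is at most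
2 |J|^-1 ([tsum_oscillation_le]).  The total is bounded by the sum of DB(J)^2,
hence by ||g||^2 because |J|^(1 - 2s) >= 1.

All estimates are carried out on finite subtrees ([tsum]), where they follow by
induction on the depth ([tsum_prod_diff_le]).  Completeness of the Haar system
enters only in the passage to the limit ([covariation_cvg]): the step functions of
the averages at level n converge to f almost everywhere and are uniformly
bounded, so that dominated convergence applies. *)

(** * Sums over finite dyadic trees *)

Section TreeSums.
Context {R : realType}.
Implicit Types (w : nat * nat -> R) (I J : nat * nat) (d : nat).

Fixpoint tsum w d I : R :=
  if d is d'.+1 then w I + (tsum w d' (dleft I) + tsum w d' (dright I)) else 0.

Lemma dyadic_left I : dyadic I -> dyadic (dleft I).
Proof. rewrite /dyadic/= expnS; lia. Qed.

Lemma dyadic_right I : dyadic I -> dyadic (dright I).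
Proof. rewrite /dyadic/= expnS; lia. Qed.

(** Every dyadic interval is reached from the root by successive halving. *)
Lemma dyadic_ind (P : nat * nat -> Prop) : P (0, 0)%N ->
  (forall I, dyadic I -> P I -> P (dleft I)) ->
  (forall I, dyadic I -> P I -> P (dright I)) ->
  forall I, dyadic I -> P I.
Proof.
move=> P0 Pl Pr [j k]; elim: j k => [|j IH] k.
  by rewrite /dyadic/= expn0 ltnS leqn0 => /eqP ->.
move=> Dk; have Dk2 : dyadic (j, k./2) by move: Dk; rewrite /dyadic/= expnS; lia.
rewrite -(odd_double_half k); case: (odd k); first exact: Pr (IH _ Dk2).
exact: Pl (IH _ Dk2).
Qed.

Lemma le_tsum w1 w2 d I : dyadic I ->
  (forall J, dyadic J -> w1 J <= w2 J) -> tsum w1 d I <= tsum w2 d I.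
Proof.
move=> DI w12; elim: d I DI => [//|d IH] I DI /=.
by rewrite !lerD ?w12 ?IH//; [exact: dyadic_left|exact: dyadic_right].
Qed.

Lemma tsum_ge0 w d I : (forall J, 0 <= w J) -> 0 <= tsum w d I.
Proof. by move=> w0; elim: d I => [//|d IH] I /=; rewrite !addr_ge0. Qed.

Lemma tsumD w1 w2 d I :
  tsum (fun J => w1 J + w2 J) d I = tsum w1 d I + tsum w2 d I.
Proof. by elim: d I => [|d IH] I /=; rewrite ?addr0// !IH; ring. Qed.

Lemma tsumZ c w d I : tsum (fun J => c * w J) d I = c * tsum w d I.
Proof. by elim: d I => [|d IH] I /=; rewrite ?mulr0// !IH; ring. Qed.

Lemma tsum_leS w d I : (forall J, 0 <= w J) -> tsum w d I <= tsum w d.+1 I.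
Proof.
move=> w0; elim: d I => [|d IH] I; first exact: tsum_ge0.
by rewrite [leLHS]/= [leRHS]/= lerD2l lerD// IH.
Qed.

Lemma tsum_leD w d d' I : (forall J, 0 <= w J) ->
  tsum w d I <= tsum w (d' + d) I.
Proof.
move=> w0; elim: d' => [//|d' IH].
by rewrite (le_trans IH)// addSn tsum_leS.
Qed.

(** The subtree of depth d below I is part of the tree of depth I.1 + d below
the root; this transfers bounds known at the root to every subtree. *)
Lemma tsum_le_root w I : (forall J, 0 <= w J) -> dyadic I ->
  forall d, tsum w d I <= tsum w (I.1 + d) (0, 0)%N.
Proof.
move=> w0; elim/dyadic_ind => [//|{}I _ IH|{}I _ IH] d;
  rewrite addSnnS; apply: le_trans (IH d.+1); rewrite [leRHS]/=.
- by rewrite addrCA lerDl addr_ge0// tsum_ge0.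
- by rewrite addrA lerDr addr_ge0// tsum_ge0.
Qed.

(** The inductive step of Cauchy-Schwarz on a tree: the cross terms obey
2 a1 a2 <= b1 c2 + b2 c1 by the arithmetic-geometric mean inequality. *)
Lemma cauchy_schwarzD (a1 a2 b1 b2 c1 c2 : R) :
  0 <= b1 -> 0 <= b2 -> 0 <= c1 -> 0 <= c2 ->
  a1 ^+ 2 <= b1 * c1 -> a2 ^+ 2 <= b2 * c2 ->
  (a1 + a2) ^+ 2 <= (b1 + b2) * (c1 + c2).
Proof.
move=> b10 b20 c10 c20 h1 h2.
have h12 : 2 * (a1 * a2) <= b1 * c2 + b2 * c1.
  rewrite (le_trans (ler_norm _))// -[leRHS]ger0_norm; last first.
    by rewrite addr_ge0// mulr_ge0.
  rewrite -ler_sqr ?nnegrE//.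
  have := ler_pM (sqr_ge0 _) (sqr_ge0 _) h1 h2.
  rewrite !real_normK ?num_real//.
  have := sqr_ge0 (b1 * c2 - b2 * c1); lra.
lra.
Qed.

Lemma tsum_cauchy_schwarz u v w d I : (forall J, 0 <= w J) ->
  (tsum (fun J => w J * u J * v J) d I) ^+ 2 <=
  tsum (fun J => w J * u J ^+ 2) d I * tsum (fun J => w J * v J ^+ 2) d I.
Proof.
move=> w0; elim: d I => [|d IH] I /=; first by rewrite expr0n/= mulr0.
have wu0 J : 0 <= w J * u J ^+ 2 by rewrite mulr_ge0 ?sqr_ge0.
have wv0 J : 0 <= w J * v J ^+ 2 by rewrite mulr_ge0 ?sqr_ge0.
apply: cauchy_schwarzD; rewrite ?addr_ge0 ?tsum_ge0//.
  by rewrite le_eqVlt; apply/orP; left; apply/eqP; ring.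
by apply: cauchy_schwarzD; rewrite ?tsum_ge0.
Qed.

(** Reading the tree level by level: the i-th generation below (j, k) consists
of the 2^i indices (j + i, k 2^i + l). *)
Lemma tsum_levels w d I :
  tsum w d I = \sum_(i < d) \sum_(l < 2 ^ i) w (I.1 + i, I.2 * 2 ^ i + l)%N.
Proof.
elim: d I => [|d IH] I /=; first by rewrite big_ord0.
rewrite big_ord_recl big_ord1/= !addn0 muln1 -surjective_pairing !IH.
congr (_ + _); rewrite -big_split; apply: eq_bigr => i _ /=.
rewrite -(big_mkord xpredT (fun l => w (I.1.+1 + i, I.2.*2 * 2 ^ i + l)%N)).
rewrite -(big_mkord xpredT (fun l => w (I.1.+1 + i, I.2.*2.+1 * 2 ^ i + l)%N)).
rewrite -(big_mkord xpredT (fun l => w (I.1 + bump 0 i, I.2 * 2 ^ (bump 0 i) + l)%N)).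
rewrite /bump leq0n/= add1n expnS [RHS](@big_cat_nat _ _ _ (2 ^ i)%N)//=; last lia.
congr (_ + _).
  by apply: eq_big_nat => l _; congr (w (_, _)); lia.
rewrite [RHS](_ : _ = \sum_(0 + 2 ^ i <= l < 2 ^ i + 2 ^ i)
    w (I.1 + i.+1, I.2 * (2 * 2 ^ i) + l)%N); last by rewrite add0n mul2n addnn.
rewrite big_addn addnK.
by apply: eq_big_nat => l _; congr (w (_, _)); lia.
Qed.

Lemma dyadic_esum w : (forall J, 0 <= w J) ->
  (\esum_(I in dyadic) (w I)%:E =
   \sum_(j <oo) (\sum_(k < 2 ^ j) w (j, nat_of_ord k))%:E)%E.
Proof.
move=> w0; rewrite nneseries_esumT; last first.
  by move=> j; rewrite lee_fin sumr_ge0.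
transitivity (\esum_(j in [set: nat]) \esum_(k in `I_(2 ^ j)) (w (j, k))%:E)%E.
  rewrite esum_esum; last by move=> *; rewrite lee_fin.
  rewrite (_ : _ `*`` _ = dyadic); first by apply: eq_esum => -[].
  by apply/seteqP; split => [[j k] []|[j k]].
apply: eq_esum => j _.
rewrite esum_fset//; last by move=> *; rewrite lee_fin.
by rewrite -fsbig_ord sumEFin.
Qed.

Lemma tsum_root w d :
  (tsum w d (0, 0)%N)%:E = (\sum_(0 <= j < d) (\sum_(k < 2 ^ j) w (j, nat_of_ord k))%:E)%E.
Proof.
rewrite tsum_levels big_mkord -sumEFin.
by apply: eq_bigr => i _; congr EFin; apply: eq_bigr => k _.
Qed.

Lemma tsum_le_esum w d : (forall J, 0 <= w J) ->
  ((tsum w d (0, 0)%N)%:E <= \esum_(I in dyadic) (w I)%:E)%E.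
Proof.
move=> w0; rewrite dyadic_esum// tsum_root; apply: nneseries_lim_ge => j _ _.
by rewrite lee_fin sumr_ge0.
Qed.

Lemma esum_le_tsum w B : (forall J, 0 <= w J) ->
  (forall d, tsum w d (0, 0)%N <= B) ->
  (\esum_(I in dyadic) (w I)%:E <= B%:E)%E.
Proof.
move=> w0 wB; rewrite dyadic_esum//; apply: lime_le.
  by apply: is_cvg_nneseries => j _ _; rewrite lee_fin sumr_ge0.
by apply: nearW => d; rewrite -tsum_root lee_fin.
Qed.

End TreeSums.

(** * Martingale estimates on the dyadic tree *)

Section DiscreteMartingales.
Context {R : realType}.
Implicit Types (A B : nat * nat -> R) (I J : nat * nat) (s H : R) (d : nat).

Definition dyadic_martingale A :=
  forall I, dyadic I -> A (dleft I) + A (dright I) = 2 * A I.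

Definition mdiff A I : R := (A (dleft I) - A (dright I)) / 2.

Lemma martingale_left {A I} : dyadic_martingale A -> dyadic I ->
  A (dleft I) = A I + mdiff A I.
Proof. by move=> mA DI; have := mA I DI; rewrite /mdiff; lra. Qed.

Lemma martingale_right {A I} : dyadic_martingale A -> dyadic I ->
  A (dright I) = A I - mdiff A I.
Proof. by move=> mA DI; have := mA I DI; rewrite /mdiff; lra. Qed.

Lemma dlen_gt0 I : 0 < dlen R I.
Proof. by rewrite /dlen exprn_gt0. Qed.

Lemma dlen_le1 I : dlen R I <= 1.
Proof. by rewrite /dlen exprn_ile1//; lra. Qed.

Lemma dlen_left I : dlen R (dleft I) = dlen R I / 2.
Proof. by rewrite /dlen/= exprS mulrC. Qed.

Lemma dlen_right I : dlen R (dright I) = dlen R I / 2.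
Proof. by rewrite /dlen/= exprS mulrC. Qed.

(** A weight that decreases down the tree can be frozen at its value at the top. *)
Lemma tsum_weight_le (w e : nat * nat -> R) d I : (forall J, 0 <= e J) ->
  (forall J, w (dleft J) <= w J) -> (forall J, w (dright J) <= w J) ->
  tsum (fun J => w J * e J) d I <= w I * tsum e d I.
Proof.
move=> e0 wl wr; elim: d I => [|d IH] I /=; first by rewrite mulr0.
rewrite !mulrDr lerD2l lerD// (le_trans (IH _))// ler_wpM2r ?tsum_ge0//.
Qed.

(** For the averages A of f, this is |J|^(-2s) (f, h_J)^2. *)
Definition energy s A J : R := dlen R J `^ (1 - 2 * s) * mdiff A J ^+ 2.

Lemma energy_ge0 s A J : 0 <= energy s A J.
Proof. by rewrite mulr_ge0 ?powR_ge0 ?sqr_ge0. Qed.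

Definition energy_bounded s A H := forall d, tsum (energy s A) d (0, 0)%N <= H.

(** For the averages A of f, this is a truncation of the Haar expansion of the
square integral of f - A(I) over I. *)
Definition oscillation A d I : R :=
  tsum (fun J => dlen R J * mdiff A J ^+ 2) d I.

Lemma oscillation_ge0 A d I : 0 <= oscillation A d I.
Proof. by apply: tsum_ge0 => J; rewrite mulr_ge0 ?sqr_ge0// ltW// dlen_gt0. Qed.

Lemma tsum_energy_le s A H d I : energy_bounded s A H -> dyadic I ->
  tsum (energy s A) d I <= H.
Proof.
move=> AH DI; apply: le_trans (AH (I.1 + d)%N).
by apply: tsum_le_root => // J; exact: energy_ge0.
Qed.

(** Inside I, |J| = |J|^(2s) |J|^(1 - 2s) <= |I|^(2s) |J|^(1 - 2s). *)
Lemma oscillation_le s A H d I : 0 <= s -> energy_bounded s A H -> dyadic I ->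
  oscillation A d I <= dlen R I `^ (2 * s) * H.
Proof.
move=> s0 AH DI.
have -> : oscillation A d I =
    tsum (fun J => dlen R J `^ (2 * s) * energy s A J) d I.
  congr (tsum _ d I); apply/funext => J; rewrite /energy mulrA -powRD.
    by rewrite [X in _ `^ X](_ : _ = 1) ?powRr1 ?ltW ?dlen_gt0//; ring.
  by rewrite (gt_eqF (dlen_gt0 J)) implybT.
apply: (le_trans (tsum_weight_le _ _ _ _ _)) => [J|J|J|].
- exact: energy_ge0.
- rewrite ge0_ler_powR ?nnegrE ?mulr_ge0// ?ltW ?dlen_gt0//.
  by rewrite dlen_left; have := dlen_gt0 J; lra.
- rewrite ge0_ler_powR ?nnegrE ?mulr_ge0// ?ltW ?dlen_gt0//.
  by rewrite dlen_right; have := dlen_gt0 J; lra.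
- by rewrite ler_wpM2l ?powR_ge0// tsum_energy_le.
Qed.

(** Exchanging the two summations amounts to summing |I|^-1 over the ancestors I
of J, a geometric series bounded by 2 |J|^-1.  The second term on the left is
the part of that series still available above the top interval; it makes the
induction on m close: halving an interval doubles |I|^-1. *)
Lemma tsum_oscillation_le A m d I :
  tsum (fun J => (dlen R J)^-1 * oscillation A d J) m I +
    (dlen R I)^-1 * oscillation A (m + d) I <=
  2 * tsum (fun J => mdiff A J ^+ 2) (m + d) I.
Proof.
have D0 J : 0 <= mdiff A J ^+ 2 by exact: sqr_ge0.
have w0 J : 0 <= dlen R J * mdiff A J ^+ 2 by rewrite mulr_ge0// ltW ?dlen_gt0.
elim: m I => [|m IH] I.
  rewrite add0r add0n ler_pdivrMl ?dlen_gt0//.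
  rewrite (@le_trans _ _ (dlen R I * tsum (fun J => mdiff A J ^+ 2) d I))//.
    apply: tsum_weight_le => // J; rewrite ?(dlen_left, dlen_right);
      by have := dlen_gt0 J; lra.
  rewrite ler_wpM2l ?(ltW (dlen_gt0 I))//.
  by have := tsum_ge0 d I D0; lra.
have := IH (dleft I); have := IH (dright I).
have : oscillation A d I <= oscillation A (m.+1 + d) I by apply: tsum_leD.
rewrite -(@ler_pM2l _ (dlen R I)^-1) ?invr_gt0 ?dlen_gt0//.
have -> : oscillation A (m.+1 + d) I = dlen R I * mdiff A I ^+ 2 +
  (oscillation A (m + d) (dleft I) + oscillation A (m + d) (dright I)) by [].
rewrite addSn/= dlen_left dlen_right !mulrDr mulKf ?gt_eqF ?dlen_gt0//.
have -> : (dlen R I / 2)^-1 = (dlen R I)^-1 * 2.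
  by rewrite invfM invrK.
lra.
Qed.

(** The ratio of the geometric bound on martingale differences: it is below 1
exactly when s > 1/2. *)
Definition decay s : R := 2^-1 `^ (s - 2^-1).

Definition sup_const s : R := 1 + (1 - decay s)^-1.

Lemma decay_ge0 s : 0 <= decay s. Proof. exact: powR_ge0. Qed.

Lemma decay_lt1 s : 2^-1 < s -> decay s < 1.
Proof.
move=> hs; rewrite /decay.
rewrite -[ltRHS]/((fun=> 1) (s - 2^-1)) -powR1.
by apply: gt0_ltr_powR; rewrite ?nnegrE; lra.
Qed.

(** A single term of a nonnegative sum is bounded by the sum. *)
Lemma mdiff_le s A H I : energy_bounded s A H -> dyadic I ->
  `|mdiff A I| <= decay s ^+ I.1 * Num.sqrt H.
Proof.
move=> AH DI; have H0 : 0 <= H by exact: AH 0%N.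
rewrite -[leRHS]ger0_norm; last by rewrite mulr_ge0 ?exprn_ge0 ?decay_ge0.
rewrite -ler_sqr ?nnegrE// !real_normK ?num_real// [leRHS]exprMn sqr_sqrtr//.
have <- : dlen R I `^ (2 * s - 1) = (decay s ^+ I.1) ^+ 2.
  rewrite -exprM /dlen /decay -!powR_mulrn ?powR_ge0//.
  rewrite -!powRrM natrM; congr (_ `^ _); lra.
have := tsum_energy_le 1 AH DI; rewrite /= !addr0 /energy.
rewrite (_ : 1 - 2 * s = - (2 * s - 1)); last ring.
by rewrite powRN ler_pdivrMl// powR_gt0 ?dlen_gt0.
Qed.

(** The sup bound behind the algebra property.  Along a chain of descendants the
increments are dominated by a geometric series, whose tail
r^j / (1 - r) is carried in the induction on the tree. *)
Lemma martingale_bounded s A H I : 2^-1 < s -> dyadic_martingale A ->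
  energy_bounded s A H -> A (0, 0)%N ^+ 2 <= H -> dyadic I ->
  `|A I| <= sup_const s * Num.sqrt H.
Proof.
move=> hs mA AH A0 DI; set N := Num.sqrt H; set r := decay s.
have N0 : 0 <= N by exact: sqrtr_ge0.
have r0 : 0 <= r by exact: decay_ge0.
have r1 : 0 < 1 - r by rewrite subr_gt0 decay_lt1.
have q0 : 0 <= (1 - r)^-1 by rewrite invr_ge0 ltW.
have step x y j : `|y| <= r ^+ j * N ->
  `|x| + r ^+ j / (1 - r) * N <= sup_const s * N ->
  `|x + y| + r ^+ j.+1 / (1 - r) * N <= sup_const s * N.
  move=> yj; apply: le_trans.
  have -> : r ^+ j / (1 - r) * N = r ^+ j * N + r ^+ j.+1 / (1 - r) * N.
    by rewrite exprS; field; rewrite gt_eqF.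
  by have := ler_normD x y; lra.
suff : `|A I| + r ^+ I.1 / (1 - r) * N <= sup_const s * N.
  apply: le_trans; rewrite lerDl; apply: mulr_ge0 => //.
  by apply: mulr_ge0 => //; rewrite exprn_ge0.
elim/dyadic_ind: DI => [|J DJ|J DJ].
- rewrite expr0 mul1r mulrDl mul1r lerD2r -sqrtr_sqr ler_sqrt//.
  exact: le_trans (sqr_ge0 _) A0.
- by rewrite martingale_left//; apply: step; exact: mdiff_le.
- rewrite martingale_right//; apply: step; rewrite normrN; exact: mdiff_le.
Qed.

(** For the averages A, B of f, g, this is a truncation of the Haar expansion of
the integral of (f - A(I)) (g - B(I)) over I. *)
Definition covariation A B d I : R :=
  tsum (fun J => dlen R J * mdiff A J * mdiff B J) d I.

(** The martingale difference at I of the averages of a product, with the two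
covariations over the halves of I truncated at depth d. *)
Definition prod_diff A B d I : R := A I * mdiff B I + B I * mdiff A I +
  (dlen R I)^-1 * (covariation A B d (dleft I) - covariation A B d (dright I)).

Lemma covariation_sqr_le A B d I :
  covariation A B d I ^+ 2 <= oscillation A d I * oscillation B d I.
Proof. by apply: tsum_cauchy_schwarz => J; rewrite ltW// dlen_gt0. Qed.

(** Cauchy-Schwarz on both halves of I; one factor is then spent on the decay
|I|^(2s), which pays for the weight |I|^(1 - 2s) and leaves |I|^-1 on the
oscillation of the other factor. *)
Lemma covariation_diff_le s A B H d I : 2^-1 < s -> energy_bounded s A H ->
  dyadic I ->
  dlen R I `^ (1 - 2 * s) *
   ((dlen R I)^-1 * (covariation A B d (dleft I) - covariation A B d (dright I))) ^+ 2 <=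
  2 * H * ((dlen R I)^-1 * oscillation B d.+1 I).
Proof.
move=> hs AH DI.
have l0 := dlen_gt0 I.
have H0 : 0 <= H by exact: AH 0%N.
have oB J : 0 <= oscillation B d J by exact: oscillation_ge0.
have child J : dyadic J -> dlen R J <= dlen R I ->
    covariation A B d J ^+ 2 <= dlen R I `^ (2 * s) * H * oscillation B d J.
  move=> DJ JI; apply: (le_trans (covariation_sqr_le _ _ _ _)).
  rewrite ler_wpM2r//; apply: (le_trans (oscillation_le d _ AH DJ)); first lra.
  rewrite ler_wpM2r// ge0_ler_powR ?nnegrE// ?ltW ?dlen_gt0//; lra.
have := child _ (dyadic_left DI); rewrite dlen_left => /(_ ltac:(lra)).
have := child _ (dyadic_right DI); rewrite dlen_right => /(_ ltac:(lra)).
set x := covariation A B d (dleft I); set y := covariation A B d (dright I) => hy hx.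
have -> : oscillation B d.+1 I = dlen R I * mdiff B I ^+ 2 +
  (oscillation B d (dleft I) + oscillation B d (dright I)) by [].
set p := dlen R I `^ (2 * s) in hx hy.
have p0 : 0 < p by rewrite powR_gt0.
have -> : dlen R I `^ (1 - 2 * s) = dlen R I / p.
  rewrite powRB ?powRr1 ?ltW//.
  by rewrite (gt_eqF l0) implybT.
set l := dlen R I in l0 *.
have -> : l / p * (l^-1 * (x - y)) ^+ 2 = l^-1 * (p^-1 * (x - y) ^+ 2).
  by field; rewrite !gt_eqF.
rewrite [leRHS]mulrCA ler_pM2l ?invr_gt0// ler_pdivrMl//.
have := mulr_ge0 (mulr_ge0 (ltW p0) H0)
  (mulr_ge0 (ltW l0) (sqr_ge0 (mdiff B I))).
have := sqr_ge0 (x + y).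
lra.
Qed.

(** Here |J|^(1 - 2s) >= 1 as |J| <= 1 and s > 1/2. *)
Lemma tsum_mdiff_sqr_le s A H d I : 2^-1 < s -> energy_bounded s A H ->
  dyadic I -> tsum (fun J => mdiff A J ^+ 2) d I <= H.
Proof.
move=> hs AH DI; apply: le_trans (tsum_energy_le d AH DI).
apply: le_tsum => // J _; rewrite /energy ler_peMl ?sqr_ge0//.
rewrite -[leLHS](powRr0 (dlen R J)); apply: ger_powR; last by lra.
by rewrite dlen_gt0 dlen_le1.
Qed.

(** Three terms under the square cost a factor 3; the two terms with a bounded
average contribute sup_const^2 each, and the covariation term contributes 2 from
[covariation_diff_le] times 2 from [tsum_oscillation_le]. *)
Definition alg_const s : R := 6 * sup_const s ^+ 2 + 12.

(** The product estimate for truncated trees, uniformly in the depth m of the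
outer sum and the depth d of the covariations. *)
Lemma tsum_prod_diff_le s A B HA HB m d : 2^-1 < s ->
  dyadic_martingale A -> dyadic_martingale B ->
  energy_bounded s A HA -> energy_bounded s B HB ->
  A (0, 0)%N ^+ 2 <= HA -> B (0, 0)%N ^+ 2 <= HB ->
  tsum (fun I => dlen R I `^ (1 - 2 * s) * prod_diff A B d I ^+ 2) m (0, 0)%N
  <= alg_const s * (HA * HB).
Proof.
move=> hs mA mB eA eB A0 B0; set K := sup_const s.
have HA0 : 0 <= HA by exact: eA 0%N.
have HB0 : 0 <= HB by exact: eB 0%N.
have sqr_bound (M : nat * nat -> R) H J : dyadic_martingale M ->
    energy_bounded s M H -> M (0, 0)%N ^+ 2 <= H -> dyadic J ->
    M J ^+ 2 <= K ^+ 2 * H.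
  move=> mM eM M0 DJ; have h := martingale_bounded hs mM eM M0 DJ.
  rewrite -real_normK ?num_real// -(@sqr_sqrtr _ H); last exact: eM 0%N.
  by rewrite -exprMn ler_sqr// nnegrE (le_trans _ h).
apply: (@le_trans _ _ (tsum (fun I => 3 * K ^+ 2 * HA * energy s B I +
   (3 * K ^+ 2 * HB * energy s A I +
    6 * HA * ((dlen R I)^-1 * oscillation B d.+1 I))) m (0, 0)%N)).
  apply: le_tsum => // I DI; rewrite /prod_diff /energy.
  have := covariation_diff_le B d hs eA DI.
  set c := _^-1 * _; set p := _ `^ _; set o := _^-1 * _ => hc.
  have p0 : 0 <= p by exact: powR_ge0.
  have hA := sqr_bound _ _ _ mA eA A0 DI.
  have hB := sqr_bound _ _ _ mB eB B0 DI.
  have := ler_wpM2l (mulr_ge0 p0 (sqr_ge0 (mdiff B I))) hA.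
  have := ler_wpM2l (mulr_ge0 p0 (sqr_ge0 (mdiff A I))) hB.
  set u := A I * mdiff B I; set v := B I * mdiff A I => hv hu.
  have h3 : p * (u + v + c) ^+ 2 <= p * (3 * (u ^+ 2 + v ^+ 2 + c ^+ 2)).
    rewrite ler_wpM2l//.
    have := sqr_ge0 (u - v); have := sqr_ge0 (v - c); have := sqr_ge0 (u - c).
    lra.
  apply: (le_trans h3); rewrite /u /v; clear -hc hu hv; lra.
rewrite !tsumD !tsumZ.
have r0 : dyadic (0, 0)%N by [].
have tA := tsum_energy_le m eA r0.
have tB := tsum_energy_le m eB r0.
have tO := tsum_oscillation_le B m d.+1 (0, 0)%N.
have tY := tsum_mdiff_sqr_le (m + d.+1) hs eB r0.
have {tO} : tsum (fun J => (dlen R J)^-1 * oscillation B d.+1 J) m (0, 0)%N <=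
    2 * HB.
  apply: (@le_trans _ _ (2 * tsum (fun J => mdiff B J ^+ 2) (m + d.+1) (0, 0)%N)).
    apply: le_trans tO; rewrite lerDl mulr_ge0 ?oscillation_ge0//.
    by rewrite invr_ge0 ltW// dlen_gt0.
  by rewrite ler_wpM2l.
set o := tsum _ m _ => ho.
have k0 := sqr_ge0 K.
have := ler_wpM2l (mulr_ge0 (mulr_ge0 (ler0n R 3) k0) HA0) tB.
have := ler_wpM2l (mulr_ge0 (mulr_ge0 (ler0n R 3) k0) HB0) tA.
have := ler_wpM2l (mulr_ge0 (ler0n R 6) HA0) ho.
rewrite /alg_const -/K; lra.
Qed.

End DiscreteMartingales.

(** * Dyadic averages and step functions *)

Section DyadicAverages.
Context {R : realType}.
Notation mu := (@lebesgue_measure R).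
Notation I0 := (`[0, 1]%classic : set R).
Implicit Types (f g : R -> R) (I : nat * nat).
Local Notation ditv := (@ditv R).

Lemma ditvE I : ditv I =
  `[I.2%:R * dlen R I, I.2%:R * dlen R I + dlen R I[%classic.
Proof. by rewrite /ditv -natr1 mulrDl mul1r. Qed.

Lemma measurable_ditv I : measurable (ditv I).
Proof. by rewrite /ditv; exact: measurable_itv. Qed.

Lemma ditv_split I : ditv I = ditv (dleft I) `|` ditv (dright I).
Proof.
rewrite !ditvE dlen_left dlen_right/=; have l0 := @dlen_gt0 R I.
have e : (I.2.*2%:R : R) = 2 * I.2%:R by rewrite -muln2 natrM mulrC.
have e1 : (I.2.*2.+1%:R : R) = 2 * I.2%:R + 1 by rewrite -natr1 e.
rewrite e e1; apply/seteqP; split => x /=; rewrite !in_itv/=.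
  move=> /andP[a b].
  by have [h|h] := ltP x (I.2%:R * dlen R I + dlen R I / 2);
    [left|right]; apply/andP; split; lra.
by move=> [|] /andP[a b]; apply/andP; split; lra.
Qed.

Lemma ditv_disj I : [disjoint ditv (dleft I) & ditv (dright I)].
Proof.
apply/disj_setPS => x [/=].
rewrite /ditv/= !in_itv/= => /andP[_ a] /andP[b _].
by have := lt_le_trans a b; rewrite ltxx.
Qed.

Lemma ditv_left_sub I : ditv (dleft I) `<=` ditv I.
Proof. by rewrite [X in _ `<=` X]ditv_split; exact: subsetUl. Qed.

Lemma ditv_right_sub I : ditv (dright I) `<=` ditv I.
Proof. by rewrite [X in _ `<=` X]ditv_split; exact: subsetUr. Qed.

Lemma ditv_root : ditv (0, 0)%N = `[0, 1[%classic.
Proof. by rewrite /ditv/dlen/= expr0 !mulr1. Qed.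

Lemma ditv_sub_root I : dyadic I -> ditv I `<=` `[0, 1[%classic.
Proof.
elim/dyadic_ind => [|{}I _ IH|{}I _ IH]; first by rewrite ditv_root => x.
- exact: subset_trans (@ditv_left_sub I) IH.
- exact: subset_trans (@ditv_right_sub I) IH.
Qed.

Lemma ditv_sub01 I : dyadic I -> ditv I `<=` I0.
Proof.
by move=> DI x /(ditv_sub_root DI)/=; rewrite !in_itv/= => /andP[-> /ltW].
Qed.

Lemma mu_ditv I : mu (ditv I) = (dlen R I)%:E.
Proof.
rewrite ditvE lebesgue_measure_itv/= lte_fin ltrDl dlen_gt0 -EFinB.
by rewrite addrAC subrr add0r.
Qed.

Lemma integrable_ditv f I : dyadic I -> mu.-integrable I0 (EFin \o f) ->
  mu.-integrable (ditv I) (EFin \o f).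
Proof.
by move=> DI; apply: integrableS => //; [exact: measurable_ditv|exact: ditv_sub01].
Qed.

Definition avg f I : R := (dlen R I)^-1 * Rintegral mu (ditv I) f.

Lemma dlen_avg f I : dlen R I * avg f I = Rintegral mu (ditv I) f.
Proof. by rewrite /avg mulrA divff ?mul1r// gt_eqF// dlen_gt0. Qed.

Lemma Rintegral_ditv_split f I : mu.-integrable (ditv I) (EFin \o f) ->
  Rintegral mu (ditv I) f =
  Rintegral mu (ditv (dleft I)) f + Rintegral mu (ditv (dright I)) f.
Proof.
rewrite ditv_split => fi; rewrite Rintegral_setU//; try exact: measurable_ditv.
exact: ditv_disj.
Qed.

Lemma avg_martingale f : mu.-integrable I0 (EFin \o f) ->
  dyadic_martingale (avg f).
Proof.
move=> fi I DI; rewrite /avg (Rintegral_ditv_split (integrable_ditv DI fi)).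
rewrite dlen_left dlen_right; field; by rewrite gt_eqF// dlen_gt0.
Qed.

(** This identity replaces Haar coefficients by martingale differences. *)
Lemma inner01_haar f I : mu.-integrable I0 (EFin \o f) -> dyadic I ->
  inner01 f (haar I) = Num.sqrt (dlen R I) * mdiff (avg f) I.
Proof.
move=> fi DI; rewrite /inner01.
have sub J : dyadic J ->
    Rintegral mu I0 (fun x => f x * \1_(ditv J) x) = dlen R J * avg f J.
  move=> DJ; rewrite dlen_avg.
  rewrite [in RHS](_ : ditv J = I0 `&` ditv J); last first.
    by rewrite setIidr//; exact: ditv_sub01.
  rewrite Rintegral_mkcondr; apply: eq_Rintegral => x _.
  by rewrite patchE indicE; case: ifPn => _; rewrite ?mulr1 ?mulr0.
have intJ J : dyadic J ->
    mu.-integrable I0 (EFin \o (fun x => f x * \1_(ditv J) x)).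
  move=> DJ; apply: (le_integrable _ _ _ fi) => //.
    apply/measurable_EFinP; apply: measurable_funM.
      by apply/measurable_EFinP; exact: measurable_int fi.
    by apply: measurable_indic; exact: measurable_ditv.
  move=> x _ /=; rewrite lee_fin normrM indicE.
  by case: (_ \in _); rewrite ?normr1 ?normr0 ?mulr1 ?mulr0.
under eq_Rintegral do rewrite /haar mulrCA mulrBr.
have Dl := dyadic_left DI; have Dr := dyadic_right DI.
rewrite RintegralZl//; last first.
  rewrite (_ : _ \o _ = ((EFin \o (fun x => (f x * \1_(ditv (dleft I)) x)%R)) \-
    (EFin \o (fun x => (f x * \1_(ditv (dright I)) x)%R)))%E)//.
  by apply: integrableB => //; exact: intJ.
rewrite RintegralB//; try exact: intJ.
rewrite !sub// dlen_left dlen_right /mdiff.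
set a := avg f _; set b := avg f _; have l0 := @dlen_gt0 R I.
rewrite -{2 3}(@sqr_sqrtr _ (dlen R I)) ?ltW//; field.
by rewrite gt_eqF// sqrtr_gt0.
Qed.

Lemma energyE s f I : mu.-integrable I0 (EFin \o f) -> dyadic I ->
  dlen R I `^ (- (2 * s)) * `|inner01 f (haar I)| ^+ 2 = energy s (avg f) I.
Proof.
move=> fi DI; rewrite inner01_haar// real_normK ?num_real// exprMn.
have l0 := @dlen_gt0 R I; rewrite sqr_sqrtr ?ltW// mulrA /energy; congr (_ * _).
rewrite addrC powRD ?powRr1 ?ltW//.
by rewrite (gt_eqF l0) implybT.
Qed.

(** The conditional expectation of f at level n; it vanishes off [0, 1). *)
Definition stepf f n (x : R) : R :=
  \sum_(k < 2 ^ n) avg f (n, nat_of_ord k) * \1_(ditv (n, nat_of_ord k)) x.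

Lemma ditv_level_inj n k k' x : ditv (n, k) x -> ditv (n, k') x -> k = k'.
Proof.
rewrite /ditv/= !in_itv/=; have l0 := @dlen_gt0 R (n, 0)%N.
rewrite -[dlen R (n, k)]/(dlen R (n, 0)%N) -[dlen R (n, k')]/(dlen R (n, 0)%N).
move=> /andP[a b] /andP[c d].
have := le_lt_trans a d; have := le_lt_trans c b.
rewrite !ltr_pM2r// !ltr_nat; lia.
Qed.

Lemma stepfE f n k x : dyadic (n, k) -> ditv (n, k) x ->
  stepf f n x = avg f (n, k).
Proof.
rewrite /dyadic/= => kn xk; rewrite /stepf (bigD1 (Ordinal kn))//= big1.
  by rewrite addr0 indicE mem_set// mulr1.
move=> i ik; rewrite indicE memNset ?mulr0// => xi.
by move/eqP: ik; apply; apply: val_inj => /=; exact: ditv_level_inj xi xk.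
Qed.

Lemma measurable_stepf f n (D : set R) : measurable_fun D (stepf f n).
Proof.
apply: measurable_sum => k; apply: measurable_funM => //.
by apply: measurable_indic; exact: measurable_ditv.
Qed.

Lemma stepf_bounded f n x :
  `|stepf f n x| <= \sum_(k < 2 ^ n) `|avg f (n, nat_of_ord k)|.
Proof.
apply: (le_trans (ler_norm_sum _ _ _)); apply: ler_sum => k _.
rewrite normrM indicE; case: (_ \in _); rewrite ?normr1 ?normr0 ?mulr1 ?mulr0//.
Qed.

Lemma integrable_stepfM f g n I :
  mu.-integrable (ditv I) (EFin \o (fun x => stepf f n x * stepf g n x)).
Proof.
apply: measurable_bounded_integrable; first exact: measurable_ditv.
- by rewrite [X in (X < _)%E]mu_ditv ltry.
- by apply: measurable_funM; exact: measurable_stepf.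
- exists ((\sum_(k < 2 ^ n) `|avg f (n, nat_of_ord k)|) *
    (\sum_(k < 2 ^ n) `|avg g (n, nat_of_ord k)|)); split; first exact: num_real.
  move=> M /ltW HM x _ /=; apply: le_trans HM.
  by rewrite normrM ler_pM// stepf_bounded.
Qed.

(** Parseval for step functions: passing from I to its halves splits
|I| A(I) B(I) into the same quantities for the halves minus |I| DA(I) DB(I). *)
Lemma Rintegral_stepfM f g d I : dyadic_martingale (avg f) ->
  dyadic_martingale (avg g) -> dyadic I ->
  Rintegral mu (ditv I)
    (fun x => stepf f (I.1 + d) x * stepf g (I.1 + d) x) =
  dlen R I * (avg f I * avg g I) + covariation (avg f) (avg g) d I.
Proof.
move=> mf mg; elim: d I => [|d IH] I DI.
  rewrite addn0 addr0 (@eq_Rintegral _ _ _ _ _ (fun=> avg f I * avg g I)).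
    by rewrite Rintegral_cst ?[X in fine X]mu_ditv 1?mulrC//; exact: measurable_ditv.
  by case: I DI => j k DI x; rewrite inE => xI; rewrite !(stepfE _ DI xI).
rewrite Rintegral_ditv_split; last exact: integrable_stepfM.
rewrite -addSnnS (IH (dleft I)) ?(IH (dright I));
  [|exact: dyadic_right|exact: dyadic_left].
rewrite (martingale_left mf DI) (martingale_left mg DI).
rewrite (martingale_right mf DI) (martingale_right mg DI).
rewrite dlen_left dlen_right [in RHS]/covariation/= -!/(covariation _ _ _ _).
by field.
Qed.

End DyadicAverages.

(** * Almost everywhere convergence of dyadic averages *)

Section DyadicDifferentiation.
Context {R : realType}.
Notation mu := (@lebesgue_measure R).
Notation I0 := (`[0, 1]%classic : set R).
Local Notation ditv := (@ditv R).
Implicit Types (f g : R -> R) (I : nat * nat).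

(** The interval lies in the ball of radius 2^-n at x, whose measure is only
twice as large. *)
Lemma nicely_shrinking_itv (x : R) (a : R^nat) :
  (forall n, a n <= x < a n + 2^-1 ^+ n) ->
  nicely_shrinking x (fun n => `[a n, a n + 2^-1 ^+ n[%classic).
Proof.
move=> ax; split; first by move=> n; exact: measurable_itv.
have p n : 0 < (2^-1 : R) ^+ n by rewrite exprn_gt0.
exists (2, fun n => PosNum (p n)); split => //=.
- apply: cvg_expr; rewrite gtr0_norm//; lra.
- move=> n y /=; rewrite in_itv/= => /andP[h1 h2]; have /andP[h3 h4] := ax n.
  by rewrite /ball/= ltr_norml; apply/andP; split; lra.
- move=> n; rewrite lebesgue_measure_ball ?(ltW (p n))//= lebesgue_measure_itv/=.
  rewrite lte_fin ltrDl p -EFinB -EFinM.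
  by rewrite lee_fin addrAC subrr add0r mulr_natl.
Qed.

Definition dyadic_index n (x : R) : nat := Num.truncn (x * 2 ^+ n).

Lemma dyadic_indexP n (x : R) : 0 <= x < 1 ->
  dyadic (n, dyadic_index n x) /\ ditv (n, dyadic_index n x) x.
Proof.
move=> /andP[x0 x1].
have p : 0 < (2 : R) ^+ n by rewrite exprn_gt0.
have y0 : 0 <= x * 2 ^+ n by rewrite mulr_ge0// ltW.
split.
  rewrite /dyadic/= truncn_lt_nat// natrX.
  by rewrite -{2}[2 ^+ n]mul1r ltr_pM2r.
rewrite /ditv/= in_itv/= /dlen/= exprVn ler_pdivrMr// ltr_pdivlMr//.
exact: truncn_itv.
Qed.

(** Dyadic intervals around x shrink nicely, so Lebesgue differentiation applies
to f extended by zero. *)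
Lemma stepf_cvg f : mu.-integrable I0 (EFin \o f) ->
  {ae mu, forall x, 0 <= x < 1 -> stepf f n x @[n --> \oo] --> f x}.
Proof.
move=> fi; pose F := f \_ I0.
have Fi : locally_integrable [set: R] F.
  apply: open_integrable_locally; first exact: openT.
  rewrite (_ : _ \o _ = (EFin \o f) \_ I0); first by apply: (iffLR (integrable_mkcond _ _)) fi.
  by rewrite restrict_EFin.
(* The differentiation theorem wants a nicely shrinking family at every real
   point: off [0, 1) the intervals [x, x + 2^-n) serve as a filler. *)
pose a (x : R) n : R := if 0 <= x < 1 then (dyadic_index n x)%:R * 2^-1 ^+ n else x.
pose E (x : R) n : set R := `[a x n, a x n + 2^-1 ^+ n[%classic.
have nE x : nicely_shrinking x (E x).
  apply: nicely_shrinking_itv => n; rewrite /a; case: ifPn => [x01|_].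
    by have [_] := dyadic_indexP n x01; rewrite ditvE/= in_itv.
  by rewrite lexx ltrDl exprn_gt0.
apply: (@filterS _ _ (ae_filter_ringOfSetsType mu) _ _ _
  (lebesgue_differentiation Fi)) => x Fx x01.
have := nice_lebesgue_differentiation nE Fi Fx.
have -> : F x = f x.
  by rewrite /F patchE mem_set//= in_itv/=; move/andP: x01 => [-> /ltW].
move=> /fine_cvg; apply: cvg_trans; apply: near_eq_cvg; apply: nearW => n.
have [Dn xn] := dyadic_indexP n x01.
have En : E x n = ditv (n, dyadic_index n x) by rewrite /E /a x01 ditvE.
rewrite (stepfE _ Dn xn) /avg /Rintegral [LHS]/= En.
rewrite [X in (X^-1)%E]mu_ditv.
have -> : (\int[mu]_(y in ditv (n, dyadic_index n x)) (F y)%:E =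
  \int[mu]_(y in ditv (n, dyadic_index n x)) (f y)%:E)%E.
  apply: eq_integral => y; rewrite inE => /(ditv_sub01 Dn) y01.
  by rewrite /F patchE mem_set.
rewrite inver gt_eqF ?dlen_gt0// fineM//.
apply: integrable_fin_num; [exact: measurable_ditv|exact: integrable_ditv].
Qed.

End DyadicDifferentiation.

(** * Haar coefficients of a product *)

Section ProductCoefficients.
Context {R : realType}.
Notation mu := (@lebesgue_measure R).
Notation I0 := (`[0, 1]%classic : set R).
Local Notation ditv := (@ditv R).
Implicit Types (f g : R -> R) (I : nat * nat).

Lemma cvg_le_cst (u : R^nat) (l B : R) :
  u @ \oo --> l -> (forall n, u n <= B) -> l <= B.
Proof.
move=> ul uB; rewrite -(cvg_lim _ ul)//; apply: limr_le; first exact: cvgP ul.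
exact: nearW.
Qed.

Lemma ae_le_avg_bound f M : mu.-integrable I0 (EFin \o f) ->
  (forall I, dyadic I -> `|avg f I| <= M) ->
  {ae mu, forall x, I0 x -> `|f x| <= M}.
Proof.
move=> fi fM.
(* The dyadic intervals miss the right endpoint of [0, 1]. *)
have n1 : {ae mu, forall x : R, x != 1}.
  exists [set 1]; split => //; first exact: lebesgue_measure_set1.
  by move=> x /= /negP; rewrite negbK => /eqP.
apply: (@filterS2 _ _ (ae_filter_ringOfSetsType mu) _ _ _ _
  (stepf_cvg fi) n1) => x fx x1.
rewrite /= in_itv/= => /andP[x0 xle1].
have x01 : 0 <= x < 1 by rewrite x0 lt_neqAle x1.
apply: (@cvg_le_cst (fun n => `|stepf f n x|)); first by apply: cvg_norm; exact: fx.
move=> n; have [Dn xn] := dyadic_indexP n x01.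
by rewrite (stepfE _ Dn xn) fM.
Qed.

(** Polarised Parseval identity on I: the truncated Haar expansion converges to
|I| times the covariance of f and g over I.  The uniform bounds on the averages
dominate the products of step functions. *)
Lemma covariation_cvg f g Mf Mg I : mu.-integrable I0 (EFin \o f) ->
  mu.-integrable I0 (EFin \o g) ->
  (forall I, dyadic I -> `|avg f I| <= Mf) ->
  (forall I, dyadic I -> `|avg g I| <= Mg) -> dyadic I ->
  covariation (avg f) (avg g) d I @[d --> \oo] -->
    dlen R I * (avg (fun x => f x * g x) I - avg f I * avg g I).
Proof.
move=> fi gi fM gM DI.
have mI : measurable (ditv I) by exact: measurable_ditv.
have I01 x : ditv I x -> 0 <= x < 1.
  by move=> /(ditv_sub_root DI)/=; rewrite in_itv.
have mfun h : mu.-integrable I0 (EFin \o h) -> measurable_fun (ditv I) h.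
  by move=> /(integrable_ditv DI)/measurable_int/measurable_EFinP.
pose F d x := (stepf f (I.1 + d) x * stepf g (I.1 + d) x)%:E.
have [] := @dominated_convergence _ _ R mu _ mI F
  (fun x => (f x * g x)%:E) (fun=> (Mf * Mg)%:E).
- move=> d; apply/measurable_EFinP; apply: measurable_funM;
  exact: measurable_stepf.
- by apply/measurable_EFinP; apply: measurable_funM; exact: mfun.
- apply: (@filterS2 _ _ (ae_filter_ringOfSetsType mu) _ _ _ _
    (stepf_cvg fi) (stepf_cvg gi)) => x fx gx /I01 x01.
  have shift (u : R^nat) (l : R) : u @ \oo --> l ->
      u (I.1 + d)%N @[d --> \oo] --> l.
    by move=> ul; apply: cvg_comp ul; exact: cvg_addnl.
  apply: cvg_EFin; first by apply: nearW.
  by apply: cvgM; apply: (shift (fun n => stepf _ n x)); [exact: fx|exact: gx].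
- apply: measurable_bounded_integrable => //.
    by rewrite [X in (X < _)%E]mu_ditv ltry.
  exists `|Mf * Mg|; split; first exact: num_real.
  by move=> M /ltW HM x _.
- apply: aeW => x d xI; rewrite /F abse_EFin lee_fin normrM.
  have x01 := I01 _ xI; have [Dn xn] := dyadic_indexP (I.1 + d) x01.
  by rewrite !(stepfE _ Dn xn) ler_pM// ?fM ?gM.
move=> fgi _.
have fin : (\int[mu]_(x in ditv I) (f x * g x)%:E)%E \is a fin_num.
  exact: integrable_fin_num fgi.
rewrite -(fineK fin) => /fine_cvg.
have -> : dlen R I * (avg (fun x => f x * g x) I - avg f I * avg g I) =
    fine (\int[mu]_(x in ditv I) (f x * g x)%:E)%E -
    dlen R I * (avg f I * avg g I).
  by rewrite mulrBr dlen_avg.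
move=> H.
rewrite (_ : (fun d => _) = (fun d =>
   Rintegral mu (ditv I) (fun x => stepf f (I.1 + d) x * stepf g (I.1 + d) x) -
    dlen R I * (avg f I * avg g I))).
  by apply: cvgB; [exact: H|exact: cvg_cst].
apply/funext => d; rewrite Rintegral_stepfM//; [|exact: avg_martingale..].
by rewrite addrAC subrr add0r.
Qed.

Lemma prod_diff_cvg f g Mf Mg I : mu.-integrable I0 (EFin \o f) ->
  mu.-integrable I0 (EFin \o g) ->
  (forall I, dyadic I -> `|avg f I| <= Mf) ->
  (forall I, dyadic I -> `|avg g I| <= Mg) -> dyadic I ->
  prod_diff (avg f) (avg g) d I @[d --> \oo] -->
    mdiff (avg (fun x => f x * g x)) I.
Proof.
move=> fi gi fM gM DI.
have cl := covariation_cvg fi gi fM gM (dyadic_left DI).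
have cr := covariation_cvg fi gi fM gM (dyadic_right DI).
rewrite (_ : mdiff _ I = avg f I * mdiff (avg g) I + avg g I * mdiff (avg f) I +
  (dlen R I)^-1 * (dlen R (dleft I) * (avg (fun x => f x * g x) (dleft I) -
     avg f (dleft I) * avg g (dleft I)) -
   dlen R (dright I) * (avg (fun x => f x * g x) (dright I) -
     avg f (dright I) * avg g (dright I)))).
  apply: cvgD; first exact: cvg_cst.
  by apply: cvgM; [exact: cvg_cst|exact: cvgB].
rewrite dlen_left dlen_right.
rewrite (martingale_left (avg_martingale fi) DI).
rewrite (martingale_left (avg_martingale gi) DI).
rewrite (martingale_right (avg_martingale fi) DI).
rewrite (martingale_right (avg_martingale gi) DI).
rewrite {1}/mdiff; move: (mdiff (avg f) I) (mdiff (avg g) I) => u v.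
by field; rewrite gt_eqF// dlen_gt0.
Qed.

Lemma tsum_cvg (w_ : nat -> nat * nat -> R) w m I : dyadic I ->
  (forall J, dyadic J -> w_ d J @[d --> \oo] --> w J) ->
  tsum (w_ d) m I @[d --> \oo] --> tsum w m I.
Proof.
move=> DI ww; elim: m I DI => [|m IH] I DI /=; first exact: cvg_cst.
apply: cvgD; first exact: ww.
by apply: cvgD; apply: IH; [exact: dyadic_left|exact: dyadic_right].
Qed.

Lemma inL2_integrable_sqr f : inL2 f ->
  mu.-integrable I0 (EFin \o (fun x => f x ^+ 2)).
Proof.
move=> [mf foo]; apply/integrableP; split.
  by apply/measurable_EFinP; exact: measurable_funX.
rewrite (_ : (\int[mu]_(x in I0) _)%E = L2sq f)//.
apply: eq_integral => x _; rewrite /= ger0_norm ?sqr_ge0//.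
by rewrite real_normK ?num_real.
Qed.

(** On a finite measure space, |f| <= f^2 + 1 suffices. *)
Lemma inL2_integrable f : inL2 f -> mu.-integrable I0 (EFin \o f).
Proof.
move=> fL; have f2 := inL2_integrable_sqr fL.
have c1 : mu.-integrable I0 (EFin \o (fun=> 1)).
  apply: measurable_bounded_integrable => //.
    by rewrite [X in (X < _)%E]lebesgue_measure_itv/= lte_fin ltr01 -EFinB ltry.
  by exists 1; split => // M /ltW M1 x _; rewrite /= normr1.
apply: (le_integrable _ _ _ (integrableD _ f2 c1)) => //.
  by apply/measurable_EFinP; case: fL.
move=> x _ /=; rewrite lee_fin.
rewrite [leRHS]ger0_norm ?addr_ge0 ?sqr_ge0//.
rewrite -[f x ^+ 2]real_normK ?num_real//.
by have := sqr_ge0 (`|f x| - 1); have := normr_ge0 (f x); lra.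
Qed.

(** Jensen's inequality, by integrating 2 a f <= f^2 + a^2 with a the average. *)
Lemma avg_root_sqr_le f H : inL2 f -> (L2sq f <= H%:E)%E ->
  avg f (0, 0)%N ^+ 2 <= H.
Proof.
move=> fL LH; set o := (0, 0)%N; set a := avg f o.
have Do : dyadic o by [].
have mo : measurable (ditv o) by exact: measurable_ditv.
have f1 := integrable_ditv Do (inL2_integrable fL).
have f2 := integrable_ditv Do (inL2_integrable_sqr fL).
have cst_int c : mu.-integrable (ditv o) (EFin \o (fun=> c)).
  apply: measurable_bounded_integrable => //.
    by rewrite [X in (X < _)%E]mu_ditv ltry.
  by exists `|c|; split; [exact: num_real|move=> M /ltW HM x _].
have aE : Rintegral mu (ditv o) f = a.
  by rewrite -dlen_avg /dlen/= expr0 mul1r.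
have sqH : Rintegral mu (ditv o) (fun x => f x ^+ 2) <= H.
  rewrite -lee_fin fineK; last exact: integrable_fin_num f2.
  apply: le_trans LH; rewrite /L2sq.
  under [leRHS]eq_integral do rewrite real_normK ?num_real//.
  apply: ge0_subset_integral => //; last exact: ditv_sub01.
  - by apply: measurable_int; exact: inL2_integrable_sqr.
  - by move=> x _; rewrite lee_fin sqr_ge0.
have : Rintegral mu (ditv o) (fun x => (2 * a) * f x) <=
    Rintegral mu (ditv o) (fun x => f x ^+ 2 + a ^+ 2).
  apply: le_Rintegral => //.
  - rewrite (_ : _ \o _ = (fun x => (2 * a)%:E * (EFin \o f) x)%E)//.
    exact: integrableZl.
  - rewrite (_ : _ \o _ = ((EFin \o (fun x => (f x ^+ 2)%R)) \+
      (EFin \o (fun=> (a ^+ 2)%R)))%E)//.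
    apply: integrableD; [exact: mo|exact: f2|exact: cst_int].
  - by move=> x _; have := sqr_ge0 (f x - a); lra.
rewrite RintegralZl// aE RintegralD//.
rewrite Rintegral_cst// [X in fine X]mu_ditv /dlen/= expr0 mulr1.
move: sqH; clearbody a; clear; move: (Rintegral _ _ _) => S; lra.
Qed.

Lemma Dssq_energy s f : mu.-integrable I0 (EFin \o f) ->
  Dssq s f = (\esum_(I in dyadic) (energy s (avg f) I)%:E)%E.
Proof. by move=> fi; apply: eq_esum => I DI; rewrite energyE. Qed.

End ProductCoefficients.

Theorem theorem1p2 (R : realType) (s : R) (hs : 2^-1 < s < 1) :
  exists C : R, 0 < C /\
    forall f g : R -> R, inH s f -> inH s g ->
      inH s (fun x => f x * g x) /\
      (Hnorm s (fun x => (f x * g x)%R) <= C%:E * Hnorm s f * Hnorm s g)%E.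
Proof.
have {hs} hs : 2^-1 < s by case/andP: hs.
pose mu := @lebesgue_measure R.
have a0 : 0 < alg_const s + sup_const s ^+ 2.
  by rewrite /alg_const; have := sqr_ge0 (sup_const s); lra.
exists (Num.sqrt (alg_const s + sup_const s ^+ 2)); split.
  by rewrite sqrtr_gt0.
have L2ge0 (h : R -> R) : (0 <= L2sq h)%E.
  by apply: integral_ge0 => x _; rewrite lee_fin sqr_ge0.
have Dsge0 (h : R -> R) : (0 <= Dssq s h)%E.
  by apply: esum_ge0 => I _; rewrite lee_fin mulr_ge0 ?powR_ge0 ?sqr_ge0.
(* What is used of a function of finite norm, H being the squared norm. *)
have data (h : R -> R) : inH s h -> exists H : R, [/\ Hnormsq s h = H%:E,
    mu.-integrable `[0, 1] (EFin \o h), (L2sq h <= H%:E)%E, 0 <= H &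
    energy_bounded s (avg h) H /\
    forall I, dyadic I -> `|avg h I| <= sup_const s * Num.sqrt H].
  move=> [hL hfin]; have hi := inL2_integrable hL.
  have h0 : (0 <= Hnormsq s h)%E by rewrite adde_ge0.
  exists (fine (Hnormsq s h)).
  have HE : Hnormsq s h = (fine (Hnormsq s h))%:E by rewrite fineK// ge0_fin_numE.
  set H := fine _ in HE *.
  have LH : (L2sq h <= H%:E)%E by rewrite -HE /Hnormsq leeDr.
  have eH : energy_bounded s (avg h) H.
    move=> d; rewrite -lee_fin -HE /Hnormsq Dssq_energy//.
    apply: (@le_trans _ _ (\esum_(I in dyadic) (energy s (avg h) I)%:E)%E).
      by apply: tsum_le_esum => J; exact: energy_ge0.
    by rewrite leeDl.
  split => //; first by rewrite fine_ge0.
  split => // I DI; apply: martingale_bounded => //.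
    exact: avg_martingale.
  exact: avg_root_sqr_le.
move=> f g fH gH.
have [Hf [HfE fi Lf Hf0 [ef Mf]]] := data f fH.
have [Hg [HgE gi Lg Hg0 [eg Mg]]] := data g gH.
pose h x := f x * g x.
have mh : measurable_fun (`[0, 1]%classic : set R) h.
  by apply: measurable_funM; [case: fH => -[]|case: gH => -[]].
have mg : measurable_fun (`[0, 1]%classic : set R) g by case: gH => -[].
have Lh : (L2sq h <= (sup_const s ^+ 2 * (Hf * Hg))%:E)%E.
  have fM := ae_le_avg_bound fi Mf.
  apply: (@le_trans _ _ ((sup_const s ^+ 2 * Hf)%:E * L2sq g)%E).
    rewrite /L2sq -ge0_integralZl_EFin//; last 2 first.
    - apply/measurable_EFinP; apply: measurable_funX.
      exact: measurableT_comp.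
    - by rewrite mulr_ge0 ?sqr_ge0.
    apply: ae_ge0_le_integral => //.
    - apply/measurable_EFinP; apply: measurable_funX.
      exact: measurableT_comp.
    - by move=> x _; rewrite mule_ge0// lee_fin ?sqr_ge0// mulr_ge0 ?sqr_ge0.
    - apply/measurable_EFinP; apply: measurable_funM => //.
      by apply: measurable_funX; exact: measurableT_comp.
    apply: (@filterS _ _ (ae_filter_ringOfSetsType mu) _ _ _ fM) => x hx x01.
    rewrite -EFinM lee_fin normrM exprMn ler_wpM2r ?sqr_ge0//.
    rewrite -[X in _ * X](sqr_sqrtr Hf0) -exprMn ler_sqr ?nnegrE//; first exact: hx.
    exact: le_trans (normr_ge0 _) (hx x01).
  rewrite [in leRHS]mulrA [leRHS]EFinM lee_wpmul2l// lee_fin mulr_ge0 ?sqr_ge0//.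
have hL : inL2 h by split=> //; exact: le_lt_trans Lh (ltry _).
have hi := inL2_integrable hL.
have Dh : (Dssq s h <= (alg_const s * (Hf * Hg))%:E)%E.
  rewrite Dssq_energy//; apply: esum_le_tsum => [J|m]; first exact: energy_ge0.
  (* For a fixed finite tree, let the depth of the covariations go to infinity. *)
  apply: (@cvg_le_cst _ (fun d => tsum (fun I => dlen R I `^ (1 - 2 * s) *
     prod_diff (avg f) (avg g) d I ^+ 2) m (0, 0)%N)).
    apply: tsum_cvg => // I DI; apply: cvgM; first exact: cvg_cst.
    by rewrite expr2; apply: cvgM; apply: (prod_diff_cvg fi gi Mf Mg DI).
  move=> d; apply: tsum_prod_diff_le => //; try exact: avg_martingale.
  - by apply: avg_root_sqr_le => //; case: fH.
  - by apply: avg_root_sqr_le => //; case: gH.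
have Hh : (Hnormsq s h <= ((alg_const s + sup_const s ^+ 2) * (Hf * Hg))%:E)%E.
  by rewrite mulrDl EFinD; exact: leeD.
split; first by split => //; exact: le_lt_trans Hh (ltry _).
rewrite /Hnorm HfE HgE -/h.
apply: (@le_trans _ _ (sqrte
  ((alg_const s + sup_const s ^+ 2) * (Hf * Hg))%:E)).
  by rewrite lee_sqrt// lee_fin mulr_ge0 ?mulr_ge0// ltW.
by rewrite /= -!EFinM lee_fin -mulrA -!sqrtrM// ltW.
Qed.
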